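(* Let $K$ be a finite simplicial complex and let $K_1,K_2$ be sub-complexes of $K$. Then for each $p\ge 0$, $$d_{K,p}(K_1,K_2)\;\le\;\frac{\pi}{2}\cdot \Delta_p(K_1,K_2)^{1/2},$$ where $d_{K,p}(K_1,K_2)=d_{C_p(K)}(\mathcal{H}_p(K_1),\mathcal{H}_p(K_2))$ and $\Delta_p(K_1,K_2)$ is the maximum of $$\mathrm{card}\left(K_1^{[p]}\setminus K_2^{[p]}\right)+\mathrm{card}\left(K_2^{[p+1]}\setminus K_1^{[p+1]}\right)$$ and $$\mathrm{card}\left(K_2^{[p]}\setminus K_1^{[p]}\right)+\mathrm{card}\left(K_1^{[p+1]}\setminus K_2^{[p+1]}\right).$$
   Context: A finite simplicial complex $K$ is a set of (nonempty) subsets of $\{0,\dots,M\}$ for some $M$, closed under passing to (nonempty) subsets; $K^{[p]}$ is the set of its $p$-dimensional simplices (subsets of cardinality $p+1$). $C_p(K)$ is the real vector space with basis $K^{[p]}$, given the inner product for which $K^{[p]}$ is an orthonormal basis. $\partial_p:C_p(K)\to C_{p-1}(K)$ is the usual boundary map $[i_0,\dots,i_p]\mapsto\sum_j(-1)^j[i_0,\dots,\widehat{i_j},\dots,i_p]$ (with $i_0<\dots<i_p$; $\partial_0=0$). $Z_p(K)=\ker\partial_p$, $B_p(K)=\mathrm{Im}\,\partial_{p+1}$. The harmonic homology subspace is $\mathcal{H}_p(K)=Z_p(K)\cap B_p(K)^\perp\subset C_p(K)$. For a sub-complex $K'\subset K$, $C_p(K')$ is regarded as a subspace of $C_p(K)$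 (with the restricted inner product), so $\mathcal{H}_p(K')\subset C_p(K)$. For subspaces $A,B$ of a finite-dimensional real inner product space $V$ with $\dim A=k$, $\dim B=\ell$, define $$d_V(A,B)=\left(|k-\ell|\frac{\pi^2}{4}+\sum_{i=1}^{\min\{k,\ell\}}\theta_i^2\right)^{1/2},$$ where $\theta_i\in[0,\pi/2]$ is the $i$-th principal angle between $A$ and $B$. *)

(* Defs.v *)
From HB Require Import structures.
From mathcomp Require Import all_boot all_order all_algebra.
From mathcomp Require Import all_classical all_reals all_analysis.

Set Implicit Arguments.
Unset Strict Implicit.
Unset Printing Implicit Defensive.

Import Order.TTheory GRing.Theory Num.Theory.
Import numFieldNormedType.Exports.

Local Open Scope ring_scope.

Section PrincipalAngles.
Variables (R : realType) (V : vectType R) (ip : {dot V for idfun}).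
Implicit Types (A B : {vspace V}).

Definition unit_pairs A B : set (V * V) :=
  [set x | [/\ x.1 \in A, x.2 \in B, ip x.1 x.1 = 1 & ip x.2 x.2 = 1]].

Definition principal_pairs A B : set (V * V) :=
  [set ab | unit_pairs A B ab /\
    forall xy, unit_pairs A B xy -> ip xy.1 xy.2 <= ip ab.1 ab.2].

Definition principal_pair A B : V * V := xget (0, 0) (principal_pairs A B).

(* The recursive definition of principal vectors: the next pair of vectors     *)
(* maximizes the inner product among unit vectors of A and B that are          *)
(* orthogonal to the previous ones. As (x, - y) competes with (x, y), the      *)
(* maximum is in [0, 1] and the angle is in [0, pi/2].                         *)
Fixpoint principal_angles (m : nat) A B : seq R :=
  if m is m'.+1 then
    let ab := principal_pair A B in
    acos (ip ab.1 ab.2) ::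
      principal_angles m' (A :&: orthov ip <[ab.1]>) (B :&: orthov ip <[ab.2]>)
  else [::].

Definition subspace_dist A B : R :=
  let k := \dim A in let l := \dim B in
  Num.sqrt (`|k%:R - l%:R| * (pi ^+ 2 / 4) +
            \sum_(theta <- principal_angles (minn k l) A B) theta ^+ 2).

End PrincipalAngles.

(* Nonzero subspaces have a maximizing pair, so the default value of xget      *)
(* plays no role: intersecting with the orthogonal of a line decreases the     *)
(* dimension by at most 1, and subspace_dist takes min(k, l) angles.           *)
Section PrincipalPairExists.
Local Open Scope classical_set_scope.
Variables (R : realType) (V : vectType R) (ip : {dot V for idfun}).
Implicit Types (A B : {vspace V}).

Let vec A (u : 'rV[R]_(\dim A)) : V := \sum_i u 0 i *: (vbasis A)`_i.

Let vec_mem A u : @vec A u \in A.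
Proof.
by apply: memv_suml => i _; rewrite memvZ// vbasis_mem// mem_nth ?size_tuple.
Qed.

Let coords A (x : V) : 'rV[R]_(\dim A) := \row_i coord (vbasis A) i x.

Let coordsK A x : x \in A -> vec (coords A x) = x.
Proof.
move=> xA; rewrite [RHS](coord_vbasis xA).
by apply: eq_bigr => i _; rewrite mxE.
Qed.

Let vecZ A c u : @vec A (c *: u) = c *: vec u.
Proof.
by rewrite /vec scaler_sumr; apply: eq_bigr => i _; rewrite mxE scalerA.
Qed.

Let vec_eq0 A u : @vec A u = 0 -> u = 0.
Proof.
move=> u0; apply/rowP => i; rewrite mxE.
have /freeP := basis_free (vbasisP A); exact.
Qed.

Let ip_vec A B u v : ip (@vec A u) (@vec B v) =
  \sum_i \sum_j u 0 i * (v 0 j * ip (vbasis A)`_i (vbasis B)`_j).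
Proof.
rewrite -[LHS]/(applyr ip (vec v) (vec u)) linear_sum/=.
apply: eq_bigr => i _; rewrite linearZl_LR/= linear_sumr/= mulr_sumr.
by apply: eq_bigr => j _; rewrite linearZr_LR.
Qed.

Let cont_ip A B C D (f : 'rV[R]_(\dim A) * 'rV[R]_(\dim B) -> 'rV[R]_(\dim C))
  (g : 'rV[R]_(\dim A) * 'rV[R]_(\dim B) -> 'rV[R]_(\dim D)) :
  continuous f -> continuous g ->
  continuous (fun x => ip (vec (f x)) (vec (g x)) : R).
Proof.
move=> cf cg x.
have -> : (fun x => ip (vec (f x)) (vec (g x))) = (fun x =>
  \sum_i \sum_j f x 0 i * (g x 0 j * ip (vbasis C)`_i (vbasis D)`_j)).
  by apply/funext => y; exact: ip_vec.
apply: cvg_big => [|i _]; first exact: add_continuous.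
apply: cvg_big => [|j _]; first exact: add_continuous.
apply: cvgM; last apply: cvgMl.
- by apply: (@continuous_comp _ _ _ f (fun M : 'rV[R]_(\dim C) => M 0 i));
    [exact: cf|exact: coord_continuous].
- by apply: (@continuous_comp _ _ _ g (fun M : 'rV[R]_(\dim D) => M 0 j));
    [exact: cg|exact: coord_continuous].
Qed.

Let sphere n : set 'rV[R]_n := [set u | `|u| = 1].

Let sphere_compact n : compact (@sphere n).
Proof.
apply: bounded_closed_compact.
  by exists 1; split => // x x1 u /= ->; exact: ltW.
rewrite (_ : @sphere n = (fun u => `|u|) @^-1` [set 1])//.
by apply: closed_comp => [u _|]; [exact: norm_continuous|exact: closed_eq].
Qed.

Let sphere_neq0 n (u : 'rV[R]_n) : @sphere n u -> u != 0.
Proof.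
by move=> u1; apply/eqP => u0; move: u1; rewrite /sphere/= u0 normr0 => /eqP;
  rewrite eq_sym oner_eq0.
Qed.

Let normalize (x : V) := (Num.sqrt (ip x x))^-1 *: x.

Let ip_gt0 x : x != 0 -> 0 < ip x x.
Proof. exact: neq0_dnorm_gt0. Qed.

Let ip_normalize x y :
  ip (normalize x) (normalize y) =
  ip x y / (Num.sqrt (ip x x) * Num.sqrt (ip y y)).
Proof.
by rewrite linearZl_LR/= linearZr_LR/= invfM [RHS]mulrC -mulrA.
Qed.

Let normalize1 x : x != 0 -> ip (normalize x) (normalize x) = 1.
Proof.
move=> /ip_gt0 x0; rewrite ip_normalize -expr2 sqr_sqrtr ?ltW//.
by rewrite divff// gt_eqF.
Qed.

Let sphere_exists n : (0 < n)%N -> @sphere n !=set0.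
Proof.
case: n => // n _; pose c := const_mx 1 : 'rV[R]_n.+1.
have c0 : c != 0.
  by apply/eqP => /rowP/(_ ord0); rewrite !mxE; apply/eqP/oner_neq0.
exists (`|c|^-1 *: c).
by rewrite /sphere/= normrZ ger0_norm ?invr_ge0// mulVf// normr_eq0.
Qed.

Lemma principal_pairs_neq0 A B : (0 < \dim A)%N -> (0 < \dim B)%N ->
  principal_pairs ip A B !=set0.
Proof.
move=> A0 B0.
pose S := @sphere (\dim A) `*` @sphere (\dim B).
pose f (x : 'rV[R]_(\dim A) * 'rV[R]_(\dim B)) : R :=
  ip (normalize (vec x.1)) (normalize (vec x.2)).
have [u1 u1S] := sphere_exists A0; have [u2 u2S] := sphere_exists B0.
have vec_neq0 C (u : 'rV[R]_(\dim C)) : sphere u -> vec u != 0.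
  by move=> /sphere_neq0; apply: contra_neq; exact: vec_eq0.
have fE : f = fun x => ip (vec x.1) (vec x.2) /
  (Num.sqrt (ip (vec x.1) (vec x.1)) * Num.sqrt (ip (vec x.2) (vec x.2))).
  by apply/funext => x; exact: ip_normalize.
have cfst : continuous (@fst 'rV[R]_(\dim A) 'rV[R]_(\dim B)).
  by move=> x; exact: cvg_fst.
have csnd : continuous (@snd 'rV[R]_(\dim A) 'rV[R]_(\dim B)).
  by move=> x; exact: cvg_snd.
have cf : {within S, continuous f}.
  rewrite continuous_subspace_in => x /set_mem [/= x1 x2].
  rewrite /continuous_at; apply: (@continuous_subspaceT_for _ _ S f x) => //.
  rewrite /prop_for/= /continuous_at fE.
  apply: cvgM; first exact: cont_ip.
  apply: cvgV.
    by rewrite mulf_neq0// gt_eqF// sqrtr_gt0 ip_gt0// vec_neq0.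
  apply: cvgM; apply: (@continuous_comp _ _ _ _ Num.sqrt);
    [exact: cont_ip|exact: sqrt_continuous|exact: cont_ip|exact: sqrt_continuous].
have [||[v1 v2] /set_mem[/= v1S v2S] vmax] := compact_EVT_max _ _ cf.
- by exists (u1, u2).
- exact: compact_setX.
have normP C (u : 'rV[R]_(\dim C)) : normalize (vec u) \in C.
  by rewrite memvZ// vec_mem.
exists (normalize (vec v1), normalize (vec v2)); split.
  by split => //=; rewrite normalize1// vec_neq0.
move=> [x y] [/= xA yB x1 y1].
have neq0 z : ip z z = 1 -> z != 0.
  by move=> z1; apply/eqP => z0; move: z1; rewrite z0 linear0r => /eqP;
    rewrite eq_sym oner_eq0.
have nz (C : {vspace V}) z : z \in C -> ip z z = 1 ->
    exists2 u : 'rV[R]_(\dim C), sphere u & normalize (vec u) = z.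
  move=> zC z1; pose c := `|coords C z|.
  have c0 : 0 < c.
    rewrite normr_gt0; apply/eqP => cz0; have := neq0 _ z1.
    by rewrite -(coordsK zC) cz0 -[0](scale0r 0) vecZ scale0r eqxx.
  exists (c^-1 *: coords C z).
    by rewrite /sphere/= normrZ ger0_norm ?invr_ge0 ?ltW// mulVf// gt_eqF.
  rewrite vecZ coordsK// /normalize linearZl_LR/= linearZr_LR/= z1 mulr1 -expr2.
  rewrite sqrtr_sqr ger0_norm ?invr_ge0 ?ltW// invrK scalerA divff ?scale1r//.
  by rewrite gt_eqF.
have [a aS <-] := nz _ _ xA x1; have [b bS <-] := nz _ _ yB y1.
by apply: (vmax (a, b)); apply/mem_set.
Qed.

Lemma principal_pairP A B : (0 < \dim A)%N -> (0 < \dim B)%N ->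
  principal_pairs ip A B (principal_pair ip A B).
Proof. by move=> A0 B0; apply: xgetPex; exact: principal_pairs_neq0. Qed.

End PrincipalPairExists.

Section SimplicialComplexes.
Variables (R : realType) (M : nat).
Implicit Types (K L : {set {set 'I_M.+1}}) (s t : {set 'I_M.+1}) (p : nat).

Definition simplicial_complex K : Prop :=
  finset.set0 \notin K /\ forall s t, s \in K -> t \subset s -> t != finset.set0 -> t \in K.

Definition subcomplex L K : Prop := simplicial_complex L /\ L \subset K.

Definition psimplices K p : {set {set 'I_M.+1}} := [set s in K | #|s| == p.+1].

Definition chain K p := {ffun {s | s \in psimplices K p} -> R^o}.
HB.instance Definition _ K p := Vector.on (chain K p).

Definition chain_ip K p (x y : chain K p) : R := \sum_s x s * y s.

Lemma chain_ip_bilinear K p : bilinear_for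
  (GRing.Scale.Law.clone _ _ *%R _) (GRing.Scale.Law.clone _ _ (idfun \; *%R) _)
  (@chain_ip K p).
Proof.
split=> [y|x] a u v /=; rewrite /chain_ip mulr_sumr -big_split/=;
  apply: eq_bigr => s _; rewrite !ffunE/=.
  by rewrite mulrDl mulrA.
by rewrite mulrDr mulrCA.
Qed.

HB.instance Definition _ K p := bilinear_isBilinear.Build R (chain K p)
  (chain K p) R *%R (idfun \; *%R) (@chain_ip K p) (chain_ip_bilinear K p).

Lemma chain_ip_sym K p (x y : chain K p) :
  chain_ip x y = (-1) ^+ false * idfun (chain_ip y x).
Proof. by rewrite mul1r; apply: eq_bigr => s _; rewrite mulrC. Qed.

HB.instance Definition _ K p := isHermitianSesquilinear.Build R (chain K p)
  false idfun (@chain_ip K p) (@chain_ip_sym K p).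

Lemma chain_ip_gt0 K p (x : chain K p) : x != 0 -> 0 < chain_ip x x.
Proof.
move=> x0; rewrite lt_def sumr_ge0 ?andbT; last first.
  by move=> s _; rewrite -expr2 sqr_ge0.
apply: contra_neq x0 => /eqP; rewrite psumr_eq0; last first.
  by move=> s _; rewrite -expr2 sqr_ge0.
move=> /allP x0; apply/ffunP => s; rewrite ffunE.
by have := x0 s (mem_index_enum _); rewrite /= mulf_eq0 orbb => /eqP.
Qed.

HB.instance Definition _ K p := isDotProduct.Build R (chain K p)
  (@chain_ip K p) (@chain_ip_gt0 K p).

Definition coef K p (x : chain K p) s : R :=
  if insub s is Some s' then x s' else 0.

Definition basis_chain K p s : chain K p := [ffun t => (val t == s)%:R].

(* In [i_0, ..., i_p] with i_0 < ... < i_p, the position j of the vertex       *)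
(* v = i_j is the number of vertices smaller than v.                           *)
Definition simplex_boundary K p s : chain K p :=
  \sum_(v in s) (-1) ^+ #|[set u in s | (u < v)%N]| *: basis_chain K p (s :\ v).

Definition boundaryS_fun K p (x : chain K p.+1) : chain K p :=
  \sum_s x s *: simplex_boundary K p (val s).

Lemma boundaryS_is_linear K p : linear (@boundaryS_fun K p).
Proof.
move=> a x y; rewrite /boundaryS_fun scaler_sumr -big_split/=.
by apply: eq_bigr => s _; rewrite !ffunE scalerDl scalerA.
Qed.

HB.instance Definition _ K p := GRing.isLinear.Build R (chain K p.+1)
  (chain K p) *:%R (@boundaryS_fun K p) (@boundaryS_is_linear K p).

(* C_0(K) stands in for C_(-1)(K) as the codomain of the zero map. *)
Definition boundary K p : 'Hom(chain K p, chain K p.-1) :=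
  match p return 'Hom(chain K p, chain K p.-1) with
  | 0 => 0
  | q.+1 => linfun (@boundaryS_fun K q)
  end.

Definition cycles K p : {vspace chain K p} := lker (boundary K p).

Definition boundaries K p : {vspace chain K p} := limg (boundary K p.+1).

Definition chain_extend_fun L K p (x : chain L p) : chain K p :=
  [ffun s => coef x (val s)].

Lemma chain_extend_is_linear L K p : linear (@chain_extend_fun L K p).
Proof.
move=> a x y; apply/ffunP => s; rewrite !ffunE /coef.
by case: insubP => [s' _ _|_]; rewrite ?ffunE// scaler0 addr0.
Qed.

HB.instance Definition _ L K p := GRing.isLinear.Build R (chain L p)
  (chain K p) *:%R (@chain_extend_fun L K p) (@chain_extend_is_linear L K p).

Definition chain_extend L K p : 'Hom(chain L p, chain K p) :=
  linfun (@chain_extend_fun L K p).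

Definition harmonic K p : {vspace chain K p} :=
  (cycles K p :&: orthov (@chain_ip K p) (boundaries K p))%VS.

Definition harmonic_in L K p : {vspace chain K p} :=
  (chain_extend L K p @: harmonic L p)%VS.

Definition harmonic_dist K p L1 L2 : R :=
  subspace_dist (@chain_ip K p) (harmonic_in L1 K p) (harmonic_in L2 K p).

End SimplicialComplexes.

Definition Delta (M : nat) (p : nat) (L1 L2 : {set {set 'I_M.+1}}) : nat :=
  maxn (#|psimplices L1 p :\: psimplices L2 p| +
          #|psimplices L2 p.+1 :\: psimplices L1 p.+1|)%N
       (#|psimplices L2 p :\: psimplices L1 p| +
          #|psimplices L1 p.+1 :\: psimplices L2 p.+1|)%N.

(* Main.v *)
Require Import Defs.
From mathcomp Require Import all_boot all_order all_algebra.
From mathcomp Require Import all_classical all_reals all_analysis.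
From mathcomp Require Import zify lra.

Import Order.TTheory GRing.Theory Num.Theory.

Local Open Scope ring_scope.

(** The distance of two subspaces is controlled by the codimension of their
intersection in the larger one, and few linear equations cut this intersection
out of either harmonic space.

Let [A] and [B] be subspaces with intersection [C]. Each principal angle is at
most [pi / 2], and at least [\dim C] of them vanish: as long as the current
subspaces share a unit vector [c], the pair [(c, c)] attains the largest inner
product that Cauchy-Schwarz allows, so the principal pair is a vector of the
intersection paired with itself, and passing to its orthogonal complement
lowers the dimension of the intersection by one only
([sum_principal_angles_le]). Each unit of the difference of dimensions also
costs [pi ^+ 2 / 4], so the squared distance is at most [pi ^+ 2 / 4] times
[maxn (\dim A) (\dim B) - \dim C] ([subspace_dist_le]).

Inside [C_p(K)], a chain is harmonic for a subcomplex [L] exactly when it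
vanishes on the [p]-simplices outside [L], is a cycle of [K], and is orthogonal
to the boundaries of the [p+1]-simplices of [L] ([mem_harmonic_in]). Hence a
harmonic chain of [L1] is harmonic for [L2] as soon as its coefficients on the
[p]-simplices of [L1] outside [L2] vanish and it is orthogonal to the
boundaries of the [p+1]-simplices of [L2] outside [L1]: the cycle condition is
the same for both subcomplexes. Each of these equations lowers the dimension by
at most one ([dim_harmonic_cap]), and exchanging [L1] and [L2] gives the two
terms of the maximum. *)

(** * Principal angles and the dimension of the intersection *)

Lemma acos_itv_pihalf (R : realType) (x : R) :
  0 <= x <= 1 -> 0 <= acos x <= pi / 2.
Proof.
move=> /andP[x0 x1]; have x11 : -1 <= x <= 1.
  by rewrite x1 andbT (le_trans _ x0)// lerN10.
rewrite acos_ge0// leNgt; apply: contraTN x0 => pix.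
rewrite -ltNge -[x]acosK ?in_itv//= -(cos_pihalf R).
rewrite ltr_cos// in_itv/= ?acos_ge0 ?acos_lepi//.
by have := pi_gt0 R => pi0; apply/andP; split; lra.
Qed.

Section UnitVectors.
Variables (R : realType) (V : vectType R) (ip : {dot V for idfun}).
Implicit Types (A B : {vspace V}) (x y : V).

Lemma dot_sym x y : ip x y = ip y x.
Proof. by rewrite hermC mul1r. Qed.

Lemma dot_sub_unit x y : ip x x = 1 -> ip y y = 1 ->
  ip (x - y) (x - y) = 2 * (1 - ip x y).
Proof.
move=> x1 y1; rewrite linearBl/= !linearBr/= x1 y1 (dot_sym y x); lra.
Qed.

(** This is the Cauchy-Schwarz inequality for unit vectors; it holds because
the left-hand side of [dot_sub_unit] is a squared norm. *)
Lemma dot_unit_le1 x y : ip x x = 1 -> ip y y = 1 -> ip x y <= 1.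
Proof.
move=> x1 y1; have := dot_sub_unit _ _ x1 y1.
suff : 0 <= ip (x - y) (x - y) by lra.
have [->|xy0] := eqVneq (x - y) 0; first by rewrite linear0r.
by rewrite ltW// neq0_dnorm_gt0.
Qed.

Lemma dot_unit_eq1 x y : ip x x = 1 -> ip y y = 1 -> ip x y = 1 -> x = y.
Proof.
move=> x1 y1 xy1; apply/eqP; rewrite -subr_eq0; apply/negPn/negP => xy0.
have : 0 < ip (x - y) (x - y) by exact: neq0_dnorm_gt0.
by rewrite dot_sub_unit// xy1 subrr mulr0 ltxx.
Qed.

Lemma principal_pair_mem A B : (0 < \dim A)%N -> (0 < \dim B)%N ->
  unit_pairs ip A B (principal_pair ip A B).
Proof. by move=> A0 B0; have [] := principal_pairP ip A0 B0. Qed.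

(** The inner product is nonnegative because negating the second vector gives
a competing pair. *)
Lemma principal_pair_ge0_le1 A B (ab := principal_pair ip A B) :
  (0 < \dim A)%N -> (0 < \dim B)%N -> 0 <= ip ab.1 ab.2 <= 1.
Proof.
move=> A0 B0; have [[aA bB a1 b1] abmax] := principal_pairP ip A0 B0.
rewrite dot_unit_le1// andbT.
have /= := abmax (ab.1, - ab.2); rewrite linearNr/= => h.
suff : - ip ab.1 ab.2 <= ip ab.1 ab.2 by lra.
by apply: h; split=> //=; rewrite ?memvN// linearNr/= linearNl/= opprK.
Qed.

(** A unit vector of the intersection, paired with itself, attains the upper
bound 1 for the inner products of unit vectors; the principal pair then attains
it too, which is the equality case of Cauchy-Schwarz. *)
Lemma principal_pair_diag A B (ab := principal_pair ip A B) :
  (0 < \dim (A :&: B))%N ->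
  [/\ ab.1 \in (A :&: B)%VS, ab.2 = ab.1 & ip ab.1 ab.2 = 1].
Proof.
move=> C0.
have A0 : (0 < \dim A)%N by rewrite (leq_trans C0)// dimvS// capvSl.
have B0 : (0 < \dim B)%N by rewrite (leq_trans C0)// dimvS// capvSr.
have [[aA bB a1 b1] abmax] := principal_pairP ip A0 B0.
(* Any unit vector [c] of the intersection will do. *)
have [cC _ c1 _] := principal_pair_mem _ _ C0 C0.
set c := (principal_pair _ _ _).1 in cC c1.
have ab1 : ip ab.1 ab.2 = 1.
  apply/eqP; rewrite eq_le dot_unit_le1//= -c1.
  apply: (abmax (c, c)); move: cC; rewrite memv_cap => /andP[cA cB].
  by split.
have e := dot_unit_eq1 _ _ a1 b1 ab1.
by split=> //; rewrite memv_cap aA/= /ab e.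
Qed.

(** While the intersection is nonzero the next angle is 0 and the intersection
loses at most one dimension; afterwards each angle is at most [pi / 2]. *)
Lemma sum_principal_angles_le m A B : (m <= \dim A)%N -> (m <= \dim B)%N ->
  \sum_(t <- principal_angles ip m A B) t ^+ 2 <=
    pi ^+ 2 / 4 * (m - \dim (A :&: B))%:R.
Proof.
elim: m A B => [|m IH] A B mA mB; first by rewrite big_nil sub0n mulr0.
have pi4 : 0 <= (pi : R) ^+ 2 / 4 by rewrite divr_ge0// sqr_ge0.
have A0 : (0 < \dim A)%N by exact: leq_trans mA.
have B0 : (0 < \dim B)%N by exact: leq_trans mB.
rewrite /= big_cons; set ab := principal_pair ip A B.
set A' := (A :&: _)%VS; set B' := (B :&: _)%VS.
have mA' : (m <= \dim A')%N.
  by rewrite (leq_trans _ (leq_dim_orthov1 ip _ _))// -ltnS prednK.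
have mB' : (m <= \dim B')%N.
  by rewrite (leq_trans _ (leq_dim_orthov1 ip _ _))// -ltnS prednK.
have {}IH := IH A' B' mA' mB'.
have [C0|C0] := posnP (\dim (A :&: B)).
  have /acos_itv_pihalf/andP[t0 t1] := principal_pair_ge0_le1 _ _ A0 B0.
  rewrite C0 subn0 -[m.+1%:R]nat1r mulrDr mulr1 lerD//; first by nra.
  by rewrite (le_trans IH)// ler_wpM2l// ler_nat leq_subr.
have [abC ba ab1] := principal_pair_diag _ _ C0.
rewrite ab1 acos1 expr0n/= add0r (le_trans IH)// ler_wpM2l// ler_nat.
(* Both orthogonal complements are taken in the same vector [ab.1 = ab.2]. *)
have CC' : ((A :&: B) :&: orthov ip <[ab.1]> <= A' :&: B')%VS.
  by rewrite subv_cap /A' /B' ba !capvS// ?capvSl ?capvSr.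
have := leq_trans (leq_dim_orthov1 ip ab.1 (A :&: B)) (dimvS CC').
lia.
Qed.

Lemma subspace_dist_le A B : subspace_dist ip A B <=
  pi / 2 * Num.sqrt (maxn (\dim A) (\dim B) - \dim (A :&: B))%:R.
Proof.
set n := (maxn _ _ - _)%N.
have -> : pi / 2 * Num.sqrt n%:R = Num.sqrt (pi ^+ 2 / 4 * n%:R) :> R.
  rewrite sqrtrM ?divr_ge0 ?sqr_ge0//; congr (_ * _).
  have -> : (pi : R) ^+ 2 / 4 = (pi / 2) ^+ 2 by lra.
  by rewrite sqrtr_sqr ger0_norm// divr_ge0// pi_ge0.
rewrite /subspace_dist; apply: ler_wsqrtr.
have := sum_principal_angles_le _ A B (geq_minl _ _) (geq_minr _ _).
have Cmin : (\dim (A :&: B) <= minn (\dim A) (\dim B))%N.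
  by rewrite leq_min !dimvS ?capvSl ?capvSr.
have -> : `|(\dim A)%:R - (\dim B)%:R| =
    (maxn (\dim A) (\dim B) - minn (\dim A) (\dim B))%:R :> R.
  case: leqP => [AB|/ltnW AB]; rewrite natrB//.
    by rewrite distrC ger0_norm// subr_ge0 ler_nat.
  by rewrite ger0_norm// subr_ge0 ler_nat.
move=> h; rewrite [_%:R * _]mulrC; apply: le_trans (lerD (lexx _) h) _.
rewrite -mulrDr ler_wpM2l ?divr_ge0 ?sqr_ge0// -natrD ler_nat /n; lia.
Qed.

End UnitVectors.

(** * Harmonic chains of subcomplexes *)

(** Each vector of [X] imposes one linear equation on [A]. *)
Lemma dim_cap_constraints (F : fieldType) (eps : bool)
    (theta : {rmorphism F -> F}) (V : vectType F)
    (form : {hermitian V for eps & theta}) (A B : {vspace V}) (X : seq V) :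
    (forall x, x \in A -> {in X, forall v, form x v = 0} -> x \in B) ->
  (\dim A <= \dim (A :&: B) + size X)%N.
Proof.
elim: X A => [|v X IH] A AB.
  rewrite addn0 dimvS// subv_cap subvv/=.
  by apply/subvP => x xA; apply: AB.
have := leq_dim_orthov1 form v A.
rewrite -subn1 leq_subLR add1n => /leq_trans; apply.
rewrite addnS ltnS.
apply: (@leq_trans (\dim ((A :&: orthov form <[v]>) :&: B) + size X)).
  apply: IH => x; rewrite memv_cap mem_orthov1 => /andP[xA /eqP xv] xX.
  by apply: AB => // w; rewrite inE => /predU1P[->//|/xX].
by rewrite leq_add2r dimvS// capvS// capvSl.
Qed.

Section Chains.
Variables (R : realType) (M : nat).
Implicit Types (K L : {set {set 'I_M.+1}}) (s t : {set 'I_M.+1}) (p : nat).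

Lemma coef_val K p (x : chain R K p) u : coef x (val u) = x u.
Proof. by rewrite /coef valK. Qed.

Lemma coef_in K p (x : chain R K p) s (sK : s \in psimplices K p) :
  coef x s = x (exist _ s sK).
Proof. by rewrite -coef_val. Qed.

Lemma coef_out K p (x : chain R K p) s :
  s \notin psimplices K p -> coef x s = 0.
Proof. by move=> sK; rewrite /coef insubN. Qed.

(** Chain spaces of different complexes are different types, but [coef] maps
them all to functions on sets of vertices; comparing chains of a subcomplex
with chains of the whole complex is done through it. *)
Lemma coef_inj K p (x y : chain R K p) : coef x =1 coef y -> x = y.
Proof. by move=> xy; apply/ffunP => s; rewrite -!coef_val xy. Qed.

Lemma coef_sum K p (I : finType) (P : pred I) (c : I -> R)
    (F : I -> chain R K p) s :
  coef (\sum_(i | P i) c i *: F i) s = \sum_(i | P i) c i * coef (F i) s.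
Proof.
rewrite /coef; case: insubP => [u _ _|_].
  by rewrite sum_ffunE; apply: eq_bigr => i _; rewrite ffunE.
by rewrite big1// => i _; rewrite mulr0.
Qed.

Lemma sum_simplices K p (F : {set 'I_M.+1} -> R) :
  (forall s, s \notin psimplices K p -> F s = 0) ->
  \sum_(u : {s | s \in psimplices K p}) F (val u) = \sum_s F s.
Proof.
move=> F0; rewrite [RHS](bigID (mem (psimplices K p)))/= [X in _ + X]big1//.
by rewrite addr0 [RHS]big_sub.
Qed.

Lemma chain_ipE K p (x y : chain R K p) :
  chain_ip x y = \sum_s coef x s * coef y s.
Proof.
rewrite -(sum_simplices K p); last by move=> s sK; rewrite coef_out// mul0r.
by apply: eq_bigr => u _; rewrite !coef_val.
Qed.

Lemma coef_basis_chain K p s t :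
  s \in psimplices K p -> coef (basis_chain R K p s) t = (t == s)%:R.
Proof.
move=> sK; have [tK|tK] := boolP (t \in psimplices K p).
  by rewrite coef_in ffunE.
by rewrite coef_out//; have [ts|//] := eqVneq t s; rewrite ts sK in tK.
Qed.

Lemma chain_ip_basis K p (x : chain R K p) s : s \in psimplices K p ->
  chain_ip x (basis_chain R K p s) = coef x s.
Proof.
move=> sK; rewrite chain_ipE (bigD1 s)//= coef_basis_chain// eqxx mulr1.
rewrite big1 ?addr0// => t ts.
by rewrite coef_basis_chain// (negPf ts) mulr0.
Qed.

(** The entries of the boundary matrix, for sets of vertices rather than for
simplices of one complex, so that different complexes share them. *)
Definition incidence s t : R :=
  \sum_(v in s) (-1) ^+ #|[set u in s | (u < v)%N]| * (t == s :\ v)%:R.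

Lemma psimplices_facet K p s v : simplicial_complex K ->
  s \in psimplices K p.+1 -> v \in s -> s :\ v \in psimplices K p.
Proof.
move=> [_ Kdown]; rewrite !inE => /andP[sK /eqP cs] vs.
have cv : #|s :\ v| = p.+1 by move: cs; rewrite (cardsD1 v) vs => -[].
rewrite cv eqxx andbT; apply: Kdown sK _ _; first exact: subsetDl.
by rewrite -card_gt0 cv.
Qed.

Lemma coef_simplex_boundary K p s t : simplicial_complex K ->
  s \in psimplices K p.+1 ->
  coef (simplex_boundary R K p s) t = incidence s t.
Proof.
move=> cK sK; rewrite /simplex_boundary coef_sum; apply: eq_bigr => v vs.
by rewrite coef_basis_chain//; exact: psimplices_facet.
Qed.

Lemma boundaryE K p (x : chain R K p.+1) :
  boundary R K p.+1 x = \sum_u x u *: simplex_boundary R K p (val u).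
Proof. by rewrite lfunE. Qed.

Lemma coef_boundary K p (x : chain R K p.+1) t : simplicial_complex K ->
  coef (boundary R K p.+1 x) t = \sum_s coef x s * incidence s t.
Proof.
move=> cK; rewrite boundaryE coef_sum -(sum_simplices K p.+1).
  by apply: eq_bigr => u _;
    rewrite coef_simplex_boundary ?coef_val//; exact: valP.
by move=> s sK; rewrite coef_out// mul0r.
Qed.

Lemma boundary_basis_chain K p s : s \in psimplices K p.+1 ->
  boundary R K p.+1 (basis_chain R K p.+1 s) = simplex_boundary R K p s.
Proof.
move=> sK; rewrite boundaryE (bigD1 (exist _ s sK))//= ffunE eqxx scale1r.
rewrite big1 ?addr0// => u us.
rewrite ffunE (_ : (val u == s) = false) ?scale0r//.
exact: negPf us.
Qed.

(** The boundaries of the [p.+1]-simplices span the space of boundaries. *)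
Lemma mem_harmonic K p (x : chain R K p) :
  x \in Defs.harmonic R K p <-> boundary R K p x = 0 /\
    {in psimplices K p.+1, forall s, chain_ip x (simplex_boundary R K p s) = 0}.
Proof.
rewrite memv_cap memv_ker; split=> [/andP[/eqP x0 /mem_orthovP xB]|[-> xB]].
  split=> // s sK; apply: xB; rewrite -boundary_basis_chain//.
  by rewrite memv_img ?memvf.
rewrite eqxx; apply/mem_orthovP => _ /memv_imgP[c _ ->].
rewrite boundaryE linear_sumr big1// => u _ /=.
by rewrite linearZr_LR/= xB ?mulr0//; exact: valP.
Qed.

Lemma coef_chain_extend L K p (x : chain R L p) s :
  (forall t, t \notin psimplices K p -> coef x t = 0) ->
  coef (chain_extend R L K p x) s = coef x s.
Proof.
move=> xK; rewrite lfunE/=; have [sK|sK] := boolP (s \in psimplices K p).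
  by rewrite coef_in ffunE.
by rewrite xK// coef_out.
Qed.

Section Subcomplex.
Variables (K L : {set {set 'I_M.+1}}) (p : nat).
Hypotheses (cK : simplicial_complex K) (LK : subcomplex L K).

Let cL : simplicial_complex L := LK.1.

Lemma psimplices_sub q s : s \in psimplices L q -> s \in psimplices K q.
Proof. by rewrite !inE => /andP[/(fintype.subsetP LK.2)-> ->]. Qed.

Lemma coef_extend q (x : chain R L q) : coef (chain_extend R L K q x) =1 coef x.
Proof.
move=> s; apply: coef_chain_extend => t tK.
by rewrite coef_out//; apply: contra tK; exact: psimplices_sub.
Qed.

(** This is why the cycle condition is the same in [L] and in [K]. *)
Lemma boundary_extend (x : chain R L p) :
  boundary R K p (chain_extend R L K p x) =
  chain_extend R L K p.-1 (boundary R L p x).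
Proof.
case: p x => [|q] x; first by rewrite !zero_lfunE linear0.
apply: coef_inj => t; rewrite coef_extend !coef_boundary//.
by apply: eq_bigr => s _; rewrite coef_extend.
Qed.

Lemma chain_ip_extend (x : chain R L p) s : s \in psimplices L p.+1 ->
  chain_ip (chain_extend R L K p x) (simplex_boundary R K p s) =
  chain_ip x (simplex_boundary R L p s).
Proof.
move=> sL; rewrite !chain_ipE; apply: eq_bigr => t _.
by rewrite coef_extend !coef_simplex_boundary//; exact: psimplices_sub.
Qed.

(** A chain [z] on the right-hand side is the extension of its restriction to
[L], obtained by applying [chain_extend] in the opposite direction, from [K] to
[L]. *)
Lemma mem_harmonic_in (z : chain R K p) :
  z \in harmonic_in R L K p <->
  [/\ forall s, s \notin psimplices L p -> coef z s = 0,
      boundary R K p z = 0 &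
      {in psimplices L p.+1,
        forall s, chain_ip z (simplex_boundary R K p s) = 0}].
Proof.
split=> [/memv_imgP[x /mem_harmonic[x0 xB] ->]|[zL z0 zB]].
  split=> [s sL||s sL]; first by rewrite coef_extend coef_out.
  - by rewrite boundary_extend x0 linear0.
  - by rewrite chain_ip_extend// xB.
pose x := chain_extend R K L p z.
have zx : z = chain_extend R L K p x.
  by apply: coef_inj => s; rewrite coef_extend coef_chain_extend.
apply/memv_imgP; exists x => //; apply/mem_harmonic; split=> [|s sL].
  apply: coef_inj => s; rewrite -coef_extend -boundary_extend -zx z0.
  by rewrite /coef; do 2![case: insubP => [? _ _|_]]; rewrite ?ffunE.
by rewrite -chain_ip_extend// -zx zB.
Qed.

End Subcomplex.

(** A harmonic chain of [L1] is harmonic for [L2] once it satisfies one equation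
for each [p]-simplex of [L1] outside [L2] and one for each [p.+1]-simplex of
[L2] outside [L1]. *)
Lemma dim_harmonic_cap K L1 L2 p : simplicial_complex K ->
    subcomplex L1 K -> subcomplex L2 K ->
  (\dim (harmonic_in R L1 K p) <=
     \dim (harmonic_in R L1 K p :&: harmonic_in R L2 K p) +
     (#|psimplices L1 p :\: psimplices L2 p| +
      #|psimplices L2 p.+1 :\: psimplices L1 p.+1|))%N.
Proof.
move=> cK L1K L2K.
pose X :=
  [seq basis_chain R K p s | s in psimplices L1 p :\: psimplices L2 p] ++
  [seq simplex_boundary R K p s
     | s in psimplices L2 p.+1 :\: psimplices L1 p.+1].
have -> : (#|psimplices L1 p :\: psimplices L2 p| +
      #|psimplices L2 p.+1 :\: psimplices L1 p.+1|)%N = size X.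
  by rewrite size_cat !size_image.
apply: (@dim_cap_constraints _ _ _ _ (@chain_ip R M K p)) => z.
move=> /(mem_harmonic_in _ _ _ cK L1K)[zL1 z0 zB1] zX.
apply/(mem_harmonic_in _ _ _ cK L2K); split=> // s sL2.
  have [sL1|/zL1//] := boolP (s \in psimplices L1 p).
  rewrite -chain_ip_basis; last exact: psimplices_sub sL1.
  by apply: zX; rewrite mem_cat fintype.image_f// finset.in_setD sL1 sL2.
have [/zB1//|sL1] := boolP (s \in psimplices L1 p.+1).
by apply: zX; rewrite mem_cat orbC fintype.image_f// finset.in_setD sL1.
Qed.

End Chains.

Theorem theorem2p15 (R : realType) (M : nat) (K K1 K2 : {set {set 'I_M.+1}})
    (hK : simplicial_complex K) (hK1 : subcomplex K1 K)
    (hK2 : subcomplex K2 K) (p : nat) :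
  harmonic_dist R K p K1 K2 <= pi / 2 * Num.sqrt (Delta p K1 K2)%:R.
Proof.
apply: le_trans (subspace_dist_le _ _ _ _ _) _.
rewrite ler_wpM2l ?divr_ge0 ?pi_ge0// ler_wsqrtr// ler_nat.
have H1 := dim_harmonic_cap R M _ _ _ p hK hK1 hK2.
have := dim_harmonic_cap R M _ _ _ p hK hK2 hK1.
rewrite capvC => H2.
by rewrite leq_subLR geq_max /Delta addn_maxr !leq_max H1 H2 orbT.
Qed.
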